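(* For every odd integer $n \ge 13$, we have $\chi'_{st}(C_4 \,\square\, C_n) \le 7$.
   Context: A star edge-coloring of a graph $G$ is a proper edge-coloring of $G$ in which there is no bichromatic path and no bichromatic cycle of length four (i.e., with four edges). The star chromatic index $\chi'_{st}(G)$ is the minimum number of colors in a star edge-coloring of $G$. $C_m$ denotes the cycle on $m$ vertices. $G \,\square\, H$ denotes the Cartesian product: vertex set $V(G)\times V(H)$, with $(u,v)(u',v')$ an edge iff either $uu'\in E(G)$ and $v=v'$, or $u=u'$ and $vv'\in E(H)$. *)

(* Defs.v *)
From HB Require Import structures.
From mathcomp Require Import all_boot.

Set Implicit Arguments.
Unset Strict Implicit.
Unset Printing Implicit Defensive.

Record sgraph := SGraph {
  vertex :> finType;
  adj : rel vertex;
  adj_sym : symmetric adj;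
  adj_irrefl : irreflexive adj }.

Definition edges (G : sgraph) : {set {set G}} :=
  [set [set u.1; u.2] | u : G * G & adj u.1 u.2].

Section Cycle.
Variable m : nat.

(* The conjunct i != j only matters for m = 1, where ordS is the identity. *)
Definition cycle_adj : rel 'I_m :=
  [rel i j | (i != j) && ((j == ordS i) || (i == ordS j))].

Lemma cycle_adj_sym : symmetric cycle_adj.
Proof. by move=> i j; rewrite /cycle_adj /= eq_sym orbC. Qed.

Lemma cycle_adj_irrefl : irreflexive cycle_adj.
Proof. by move=> i; rewrite /cycle_adj /= eqxx. Qed.

Definition cycle_graph : sgraph := SGraph cycle_adj_sym cycle_adj_irrefl.
End Cycle.

Section CartesianProduct.
Variables G H : sgraph.

Definition cart_adj : rel (G * H)%type :=
  [rel p q | (adj p.1 q.1 && (p.2 == q.2)) || ((p.1 == q.1) && adj p.2 q.2)].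

Lemma cart_adj_sym : symmetric cart_adj.
Proof.
move=> p q; rewrite /cart_adj /= [adj q.1 _]adj_sym [adj q.2 _]adj_sym.
by rewrite [q.2 == _]eq_sym [q.1 == _]eq_sym.
Qed.

Lemma cart_adj_irrefl : irreflexive cart_adj.
Proof. by move=> p; rewrite /cart_adj /= !adj_irrefl andbF. Qed.

Definition cart_prod : sgraph := SGraph cart_adj_sym cart_adj_irrefl.
End CartesianProduct.

Section StarEdgeColoring.
Variable G : sgraph.

Definition is_path (p : seq G) : bool := sorted (@adj G) p && uniq p.

Definition is_cycle (p : seq G) : bool := cycle (@adj G) p && uniq p.

Definition path_edges (p : seq G) : seq {set G} :=
  if p is x :: q then pairmap (fun y z => [set y; z]) x q else [::].

Definition cycle_edges (p : seq G) : seq {set G} :=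
  if p is x :: q then path_edges (x :: rcons q x) else [::].

Section Coloring.
Variables (C : eqType) (c : {set G} -> C).

(* Only the values of c on [edges G] matter below. *)
Definition proper_edge_coloring : bool :=
  [forall e in edges G, forall f in edges G,
     (e != f) && (e :&: f != set0) ==> (c e != c f)].

Definition bichromatic (s : seq {set G}) : bool :=
  size (undup (map c s)) == 2.

(* A path with four edges has five vertices, a cycle with four edges four. *)
Definition star_edge_coloring : bool :=
  [&& proper_edge_coloring,
      [forall p : 5.-tuple G, is_path p ==> ~~ bichromatic (path_edges p)]
    & [forall p : 4.-tuple G, is_cycle p ==> ~~ bichromatic (cycle_edges p)]].

End Coloring.

(* Edges get colors in {0, ..., k-1}; the extra value k is only there to give
   a value to the sets that are not edges, which is needed when k = 0. *)
Definition star_edge_colorable (k : nat) : bool :=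
  [exists c : {ffun {set G} -> 'I_k.+1},
     star_edge_coloring c && [forall e in edges G, c e < k]].

Lemma set2_neq (x y z t : G) : x != z -> x != t -> [set x; y] != [set z; t].
Proof.
move=> xz xt; apply/eqP => /setP/(_ x).
by rewrite !inE eqxx (negPf xz) (negPf xt).
Qed.

Lemma not_bichromatic_inj (C : eqType) (c : {set G} -> C) a b d s :
  injective c -> a != b -> b != d -> a != d ->
  ~~ bichromatic c [:: a, b, d & s].
Proof.
move=> c_inj ab bd ad; apply/eqP => sz.
suff: 3 <= size (undup (map c [:: a, b, d & s])) by rewrite sz.
apply: (@uniq_leq_size _ [:: c a; c b; c d]).
  by rewrite /= !inE !(inj_eq c_inj) negb_or ab ad bd.
by move=> y; rewrite mem_undup /= !inE => /or3P[]/eqP->; rewrite eqxx ?orbT.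
Qed.

Lemma star_edge_colorable_exists : exists k, star_edge_colorable k.
Proof.
exists #|{: {set G}}|; apply/existsP.
pose f (e : {set G}) := widen_ord (leqnSn _) (enum_rank e).
have f_inj : injective [ffun e => f e].
  move=> e e'; rewrite !ffunE => /(congr1 val) /= ee'.
  exact/enum_rank_inj/val_inj.
exists [ffun e => f e]; apply/andP; split; last first.
  by apply/forall_inP => e _; rewrite ffunE /= ltn_ord.
apply/and3P; split.
- apply/forall_inP => e _; apply/forall_inP => e' _; apply/implyP.
  by case/andP=> ee' _; rewrite (inj_eq f_inj).
- apply/forallP => -[[|x [|y [|z [|t [|u []]]]]] //= sp].
  apply/implyP => /andP[_] /=; rewrite !inE !negb_or -!andbA.
  case/and5P => xy xz xt xu /and5P[yz yt yu zt _].
  by apply: not_bichromatic_inj => //; apply: set2_neq.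
- apply/forallP => -[[|x [|y [|z [|t []]]]] //= sp].
  apply/implyP => /andP[_] /=; rewrite !inE !negb_or -!andbA.
  case/and5P => xy xz xt yz /and3P[yt zt _].
  by apply: not_bichromatic_inj => //; apply: set2_neq.
Qed.

Definition star_chromatic_index : nat := ex_minn star_edge_colorable_exists.

End StarEdgeColoring.

(* Main.v *)
Require Import Defs.
From HB Require Import structures.
From mathcomp Require Import all_boot.

(** A column of C_4 x C_n together with the four edges leading to the next
    column carries eight colors.  Nine such columns, numbered 0, ..., 8, are
    arranged in a block 0 1 2 3 and a block 4 5 6 7 8 in such a way that every
    cyclic concatenation of these blocks is a star edge-coloring; every
    n >= 12 is of the form 4 k + 5 m, with m the residue of n modulo 4.
    Seen from its middle vertex, a walk with four edges stays within
    four consecutive columns (of the leftmost one only the edges to its right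
    are used), so that only finitely many configurations have to be examined.
    The columns were found by a computer search. *)

(** * Star edge-colorings from functions of two endpoints *)

Lemma eq_set2 (T : finType) (a b x y : T) :
  [set a; b] = [set x; y] -> (a = x /\ b = y) \/ (a = y /\ b = x).
Proof.
move=> E; have : a \in [set x; y] by rewrite -E set21.
have : b \in [set x; y] by rewrite -E set22.
have : x \in [set a; b] by rewrite E set21.
have : y \in [set a; b] by rewrite E set22.
rewrite !inE => /orP[]/eqP ? /orP[]/eqP ? /orP[]/eqP ? /orP[]/eqP ?; subst;
  by [left | right].
Qed.

Lemma size_undup4_alternate (T : eqType) (a b c d : T) :
  a != b -> b != c -> c != d -> size (undup [:: a; b; c; d]) == 2 ->
  a = c /\ b = d.
Proof.
move=> ab bc cd; rewrite /= !inE (negPf ab) (negPf bc) (negPf cd) /=.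
by case: (b =P d) => [<-|_]; rewrite ?(negPf ab); case: (a =P c); case: (a == d).
Qed.

(* Paths and cycles with four edges are both non-backtracking walks. *)
Lemma star_edge_colorable_fun (G : sgraph) (k : nat) (f : G -> G -> nat) :
  (forall x y, adj x y -> f x y = f y x) ->
  (forall x y, adj x y -> f x y < k) ->
  (forall x y z, adj x y -> adj x z -> y != z -> f x y != f x z) ->
  (forall a b c d e, adj c b -> adj b a -> adj c d -> adj d e ->
     a != c -> b != d -> c != e -> f c b = f d e -> f c d = f b a -> False) ->
  star_edge_colorable G k.
Proof.
move=> fC f_lt f_proper f_star.
(* [pick] recovers the endpoints of an edge in an unknown order, which is harmless because [f] is
   symmetric on edges; [ord_max], that is [k], is the value off the edges. *)
pose col (e : {set G}) : 'I_k.+1 :=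
  if [pick p : G * G | adj p.1 p.2 && (e == [set p.1; p.2])] is Some p
  then inord (f p.1 p.2) else ord_max.
have colE x y : adj x y -> [ffun e => col e] [set x; y] = inord (f x y).
  move=> xy; rewrite ffunE /col; case: pickP => [[u v] /= /andP[uv /eqP]|].
    by case/eq_set2 => -[-> ->] //; rewrite fC // adj_sym.
  by move/(_ (x, y)); rewrite /= xy eqxx.
have colI x y u v : adj x y -> adj u v ->
    inord (f x y) = inord (f u v) :> 'I_k.+1 -> f x y = f u v.
  by move=> xy uv /(congr1 val); rewrite /= !inordK // ltnW // ltnS f_lt.
have colN x y z : adj x y -> adj y z -> x != z ->
    inord (f x y) != inord (f y z) :> 'I_k.+1.
  move=> xy yz xz; apply/eqP => /(colI _ _ _ _ xy yz); rewrite fC // => /eqP.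
  by apply/negP/f_proper => //; rewrite adj_sym.
have walk a b c d e : adj a b -> adj b c -> adj c d -> adj d e ->
    a != c -> b != d -> c != e ->
    ~~ bichromatic [ffun e => col e]
         [:: [set a; b]; [set b; c]; [set c; d]; [set d; e]].
  move=> ab bc cd de ac bd ce; apply/negP; rewrite /bichromatic [map _ _]/=.
  rewrite !colE // => /size_undup4_alternate[]; rewrite ?colN //.
  move=> /(colI _ _ _ _ ab cd) E1 /(colI _ _ _ _ bc de) E2.
  by apply: (@f_star a b c d e); rewrite // ?[f c b]fC // 1?[f b a]fC // adj_sym.
apply/existsP; exists [ffun e => col e]; apply/andP; split; last first.
  apply/forall_inP => e /imsetP[[x y]]; rewrite inE /= => xy ->.
  by rewrite colE // inordK ?f_lt // ltnW // ltnS f_lt.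
apply/and3P; split.
- have incident e x : e \in edges G -> x \in e ->
      exists2 y, adj x y & e = [set x; y].
    case/imsetP => -[u v]; rewrite inE /= => uv -> /set2P[]->; first by exists v.
    by exists u; rewrite 1?adj_sym // setUC.
  apply/forall_inP => e eG; apply/forall_inP => e' e'G; apply/implyP.
  case/andP=> ee' /set0Pn[x /setIP[xe xe']].
  have [y xy Ey] := incident _ _ eG xe; have [z xz Ez] := incident _ _ e'G xe'.
  have yx : adj y x by rewrite adj_sym.
  rewrite Ey Ez [[set x; y]]setUC !colE // colN //.
  by apply: contraNneq ee' => yz; rewrite Ey Ez yz.
- apply/forallP => -[[|x [|y [|z [|t [|u []]]]]] //= sp].
  apply/implyP => /andP[/= /and5P[xy yz zt tu _]].
  rewrite !inE !negb_or -!andbA.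
  by case/and5P => _ xz _ _ /and5P[_ yt _ _ /andP[zu _]]; apply: walk.
- apply/forallP => -[[|x [|y [|z [|t []]]]] //= sp].
  apply/implyP => /andP[/= /and5P[xy yz zt tx _]].
  rewrite !inE !negb_or -!andbA.
  by case/and5P => _ xz _ _ /and3P[yt _ _]; apply: walk; rewrite // eq_sym.
Qed.

(** * Column states and closed state sequences *)

Definition succ_state (a : nat) : seq nat :=
  nth [::] [:: [:: 1]; [:: 2]; [:: 3]; [:: 0; 4];
               [:: 5]; [:: 6]; [:: 7]; [:: 8]; [:: 0; 4]] a.

Definition next_state : rel nat := [rel a b | b \in succ_state a].

(* Color of the edge from row i of a column in state a to the next column. *)
Definition hcolor (a i : nat) : nat :=
  nth 0 (nth [::]
    [:: [:: 4; 6; 6; 6]; [:: 0; 5; 0; 4]; [:: 1; 6; 4; 0]; [:: 6; 0; 5; 1];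
        [:: 4; 1; 4; 6]; [:: 5; 6; 0; 2]; [:: 0; 2; 6; 5]; [:: 6; 4; 1; 4];
        [:: 0; 0; 5; 1]] a) i.

(* Color of the edge between rows i and i + 1 of a column in state a. *)
Definition vcolor (a i : nat) : nat :=
  nth 0 (nth [::]
    [:: [:: 2; 4; 3; 5]; [:: 3; 1; 2; 1]; [:: 2; 1; 3; 5]; [:: 3; 1; 2; 4];
        [:: 2; 6; 3; 5]; [:: 2; 3; 1; 0]; [:: 3; 4; 3; 1]; [:: 1; 3; 0; 2];
        [:: 3; 6; 2; 5]] a) i.

Lemma cycle_next (T : eqType) (e : rel T) (x0 : T) (s : seq T) (i : nat) :
  cycle e s -> i < size s -> e (nth x0 s i) (nth x0 s (i.+1 %% size s)).
Proof.
(* The path starts at the last entry of [s]: its step 0 is the closing one, and its step [i.+1]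
   joins positions [i] and [i.+1] of [s]. *)
rewrite (cycle_path x0) => /(pathP x0) es i_lt.
have [lt|ge] := ltnP i.+1 (size s); first by rewrite modn_small //; apply: (es i.+1).
have Ei : i.+1 = size s by apply/eqP; rewrite eqn_leq i_lt.
have -> : nth x0 s i = last x0 s by rewrite -nth_last -Ei.
by rewrite Ei modnn; apply: (es 0); rewrite -Ei.
Qed.

Lemma exists_state_cycle (n : nat) :
  12 <= n -> exists2 s : seq nat, cycle next_state s & size s = n.
Proof.
move=> n_ge12; pose A := iota 0 4; pose B := iota 4 5.
pose m := n %% 4; pose s := flatten (nseq m B ++ nseq (n %/ 4 - m) A).
have m_lt : m < 4 by rewrite ltn_mod.
(* From [12 <= n] follows [m <= 3 <= n %/ 4], so the truncated subtraction in [s] is exact. *)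
have mle : m <= n %/ 4.
  by apply: leq_trans (leq_div2r 4 n_ge12); rewrite -ltnS.
(* Each block ends in 3 or 8, and both states may be followed by 0 and by 4: an invariant along any
   concatenation. *)
have ends x t : {subset t <= [:: A; B]} -> x \in [:: 3; 8] ->
    path next_state x (flatten t) && (last x (flatten t) \in [:: 3; 8]).
  elim: t x => [|b t IH] x tAB xE //=.
  have bAB := tAB b (mem_head _ _); rewrite cat_path last_cat -andbA.
  apply/andP; split.
    by move: xE bAB; rewrite !inE => /orP[]/eqP-> /orP[]/eqP->.
  apply: IH => [c ct|]; first by apply: tAB; rewrite inE ct orbT.
  by move: bAB; rewrite !inE => /orP[]/eqP->.
have sAB : {subset nseq m B ++ nseq (n %/ 4 - m) A <= [:: A; B]}.
  move=> b; rewrite mem_cat !mem_nseq.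
  by case/orP=> /andP[_ /eqP->]; rewrite !inE eqxx ?orbT.
exists s.
  (* A first run from 3 only locates the last state of [s] among 3 and 8; a second run, from that
     last state, closes the cycle. *)
  rewrite (cycle_path 3); have /andP[_ sE] := ends 3 _ sAB isT.
  by have /andP[] := ends _ _ sAB sE.
rewrite /s flatten_cat size_cat !size_flatten /shape !map_nseq !sumn_nseq /=.
rewrite [RHS](divn_eq n 4) -/m [5 * m]mulSn -addnA -mulnDr subnKC //.
by rewrite addnC mulnC.
Qed.

(** * Finite check on windows of four columns *)

(* A direction is a pair (vertical, backward). *)
Definition dir : Type := bool * bool.

Definition opp_dir (d : dir) : dir := (d.1, ~~ d.2).

(** The formulas are the values of [ordS] and [ord_pred] on ['I_4], so that windows and torus agree
    by computation. *)
Definition row_step (d : dir) (i : nat) : nat :=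
  if d.1 then if d.2 then (i + 4).-1 %% 4 else i.+1 %% 4 else i.

(* A window consists of four consecutive columns, numbered 0, 1, 2, 3; the
   middle vertex of the walks lies in column 2. *)
Definition window_color (w : nat -> nat) (k i : nat) (d : dir) : nat :=
  if d.1 then vcolor (w k) (if d.2 then (i + 4).-1 %% 4 else i)
  else hcolor (w (if d.2 then k.-1 else k)) i.

Definition window_step (d : dir) : nat :=
  if d.1 then 2 else if d.2 then 1 else 3.

(** Directions [d1] and [e1] leave the middle vertex, [d2] and [e2] prolong the two arms without
    backtracking. The walk alternates two colors when each inner edge has the color of the outer
    edge on the other arm. *)
Definition good_vertex (w : nat -> nat) (i : nat) : bool :=
  let dirs := [:: (false, false); (false, true); (true, false); (true, true)] in
  all (fun d1 => (window_color w 2 i d1 < 7) &&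
  all (fun e1 => (d1 == e1) || (window_color w 2 i d1 != window_color w 2 i e1) &&
  all (fun d2 => (d2 == opp_dir d1) ||
  all (fun e2 => (e2 == opp_dir e1) ||
    ~~ ((window_color w 2 i d1
           == window_color w (window_step e1) (row_step e1 i) e2) &&
        (window_color w 2 i e1
           == window_color w (window_step d1) (row_step d1 i) d2)))
    dirs) dirs) dirs) dirs.

Lemma mem_dirs (d : dir) :
  d \in [:: (false, false); (false, true); (true, false); (true, true)].
Proof. by case: d => [[] []]. Qed.

Lemma good_windows (a b c d i : nat) :
  next_state a b -> next_state b c -> next_state c d -> i < 4 ->
  good_vertex (nth 0 [:: a; b; c; d]) i.
Proof.
have : all (fun a => all (fun b => all (fun c => all (fun d =>
         all (good_vertex (nth 0 [:: a; b; c; d])) (iota 0 4))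
         (succ_state c)) (succ_state b)) (succ_state a)) (iota 0 9).
  by vm_compute.
move=> chk ab bc cd i_lt.
(* States beyond 8 have the empty default list of successors, so a state with a successor is covered
   by the check. *)
have a_lt : a \in iota 0 9.
  rewrite mem_iota ltnNge; apply/negP => a_ge.
  by have : b \in succ_state a := ab; rewrite /succ_state nth_default.
have i_in : i \in iota 0 4 by rewrite mem_iota.
exact: (allP (allP (allP (allP (allP chk a a_lt) b ab) c bc) d cd) i i_in).
Qed.

(** * From windows to the torus *)

Lemma ordS_neq (m : nat) (i : 'I_m) : 1 < m -> ordS i != i.
Proof.
move=> m_gt1; rewrite -val_eqE /= -[X in _ != X](modn_small (ltn_ord i)).
by rewrite -addn1 -[X in _ != X %% _]addn0 eqn_modDl mod0n modn_small.
Qed.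

Lemma ordSS_neq (m : nat) (i : 'I_m) : 2 < m -> ordS (ordS i) != i.
Proof.
move=> m_gt2; rewrite -val_eqE /= -[X in _ != X](modn_small (ltn_ord i)) -addn1 modnDml.
by rewrite addn1 -addn2 -[X in _ != X %% _]addn0 eqn_modDl mod0n modn_small.
Qed.

Section Torus.

Variables (n : nat) (st : 'I_n -> nat).
Hypothesis n_gt2 : 2 < n.

Let G := cart_prod (cycle_graph 4) (cycle_graph n).

Definition torus_step (d : dir) (x : G) : G :=
  if d.1 then (if d.2 then ord_pred x.1 else ordS x.1, x.2)
  else (x.1, if d.2 then ord_pred x.2 else ordS x.2).

Definition dir_color (x : G) (d : dir) : nat :=
  if d.1 then vcolor (st x.2) (if d.2 then ord_pred x.1 else x.1)
  else hcolor (st (if d.2 then ord_pred x.2 else x.2)) x.1.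

Definition edge_color (x y : G) : nat :=
  if x.2 == y.2 then vcolor (st x.2) (if y.1 == ordS x.1 then x.1 else y.1)
  else hcolor (st (if y.2 == ordS x.2 then x.2 else y.2)) x.1.

Lemma torus_adjP (x y : G) : adj x y -> exists d, y = torus_step d x.
Proof.
case: x y => [i j] [i' j'] /=; rewrite /cart_adj /= /cycle_adj /=.
case/orP=> [/andP[/andP[_ /orP[]/eqP->] /eqP->]|/andP[/eqP-> /andP[_ /orP[]/eqP->]]].
- by exists (true, false).
- by exists (true, true); rewrite /torus_step /= ordSK.
- by exists (false, false).
- by exists (false, true); rewrite /torus_step /= ordSK.
Qed.

Lemma torus_stepK (d : dir) (x : G) : torus_step (opp_dir d) (torus_step d x) = x.
Proof.
by case: d x => [[] []] [i j]; rewrite /torus_step /= ?ordSK ?ord_predK.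
Qed.

(** The tests in [edge_color] identify the direction because [ord_pred i], [i] and [ordS i] are
    distinct on a cycle with more than two vertices. *)
Lemma edge_color_step (x : G) (d : dir) :
  edge_color x (torus_step d x) = dir_color x d.
Proof.
have pred_neq m (i : 'I_m) : 2 < m -> (i == ord_pred i) = false.
  by move=> m_gt2; rewrite -{1}[i]ord_predK; apply/negbTE/ordS_neq/ltnW.
have pred_neqS m (i : 'I_m) : 2 < m -> (ord_pred i == ordS i) = false.
  move=> m_gt2; rewrite -{2}[i]ord_predK eq_sym; exact/negbTE/ordSS_neq.
have neqS m (i : 'I_m) : 2 < m -> (i == ordS i) = false.
  by move=> m_gt2; rewrite eq_sym; apply/negbTE/ordS_neq/ltnW.
case: d x => [[] []] [i j]; rewrite /edge_color /dir_color /torus_step /= ?eqxx //.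
- by rewrite pred_neqS.
- by rewrite pred_neq // pred_neqS.
- by rewrite neqS.
Qed.

Lemma dir_color_opp (x : G) (d : dir) :
  dir_color (torus_step d x) (opp_dir d) = dir_color x d.
Proof.
by case: d x => [[] []] [i j]; cbv [dir_color torus_step opp_dir fst snd negb];
  rewrite ?ordSK.
Qed.

Hypothesis st_next : forall j, next_state (st j) (st (ordS j)).

Definition window (j : 'I_n) : nat -> nat :=
  nth 0 [:: st (ord_pred (ord_pred j)); st (ord_pred j); st j; st (ordS j)].

Lemma window_good (j : 'I_n) (i : 'I_4) : good_vertex (window j) i.
Proof.
apply: good_windows => //.
- by rewrite -{2}[ord_pred j]ord_predK.
- by rewrite -{2}[j]ord_predK.
Qed.

Lemma dir_color_window (x : G) (d : dir) :
  dir_color x d = window_color (window x.2) 2 x.1 d.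
Proof. by case: d x => [[] []] [i j]. Qed.

(** Edges between columns are stored in the left one: two steps left read index 0 of the window, a
    step right and then left reads index 2. *)
Lemma dir_color_step_window (x : G) (d e : dir) :
  dir_color (torus_step d x) e =
  window_color (window x.2) (window_step d) (row_step d x.1) e.
Proof.
by case: d e x => [[] []] [[] []] [i j];
  rewrite /dir_color /torus_step /window_color /window /= ?ordSK.
Qed.

Lemma torus_colorable : star_edge_colorable G 7.
Proof.
apply: (@star_edge_colorable_fun _ _ edge_color).
- move=> x _ /torus_adjP[d ->].
  by rewrite -{4}[x](torus_stepK d) !edge_color_step dir_color_opp.
- move=> x _ /torus_adjP[d ->]; rewrite edge_color_step dir_color_window.
  by case/andP: (allP (window_good x.2 x.1) d (mem_dirs d)).
- move=> x _ _ /torus_adjP[d ->] /torus_adjP[e ->] neq.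
  rewrite !edge_color_step !dir_color_window.
  have /andP[_ /allP/(_ e (mem_dirs e))] := allP (window_good x.2 x.1) d (mem_dirs d).
  case/orP=> [/eqP E|]; last by case/andP.
  by case/negP: neq; rewrite E.
(* The middle vertex is [x]; [d1] and [d2] lead from it to [a], [e1] and [e2] to [d]. *)
- move=> a b x c d /torus_adjP[d1 ->] /torus_adjP[d2 ->].
  move=> /torus_adjP[e1 ->] /torus_adjP[e2 ->] nd nde ne.
  rewrite !edge_color_step !dir_color_step_window !dir_color_window => E1 E2.
  have /andP[_ /allP/(_ e1 (mem_dirs e1))] :=
    allP (window_good x.2 x.1) d1 (mem_dirs d1).
  case/orP=> [/eqP E|/andP[_]]; first by case/negP: nde; rewrite E.
  move=> /allP/(_ d2 (mem_dirs d2)).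
  case/orP=> [/eqP E|]; first by case/negP: nd; rewrite E torus_stepK.
  move=> /allP/(_ e2 (mem_dirs e2)).
  case/orP=> [/eqP E|]; first by case/negP: ne; rewrite E torus_stepK.
  by rewrite E1 E2 !eqxx.
Qed.

End Torus.

Theorem theorem15 (n : nat) (n_odd : odd n) (n_ge13 : 13 <= n) :
  star_chromatic_index (cart_prod (cycle_graph 4) (cycle_graph n)) <= 7.
Proof.
rewrite /star_chromatic_index; case: ex_minnP => k _; apply.
have [s s_cycle s_size] := exists_state_cycle n (ltnW n_ge13).
apply: (@torus_colorable n (fun j => nth 0 s j)) => [|j].
  exact: leq_trans n_ge13.
by have := cycle_next _ _ 0 _ j s_cycle; rewrite s_size => /(_ (ltn_ord j)).
Qed.
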